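(* For every set $T\subseteq\mathbb{C}$ of prime cardinality $|T|=p$ and every positive integer $D$, there exist a positive integer $n$ and a $p$-ary function $f:T^n\to T$ with $\deg(f)>D$ and $$\frac{s(f)^2}{(p-1)^3}\leq \deg(f).$$
   Context: For a finite set $T\subseteq\mathbb{C}$ of cardinality $p$, a $p$-ary function is a map $f:T^n\to T$. A polynomial $F\in\mathbb{C}[x_1,\ldots,x_n]$ represents $f$ if $F(\mathbf{x})=f(\mathbf{x})$ for all $\mathbf{x}\in T^n$; the degree $\deg(f)$ is the smallest total degree of a polynomial representing $f$. The local sensitivity $s_{\mathbf{x}}(f)$ at $\mathbf{x}\in T^n$ is the number of $\mathbf{y}\in T^n$ which differ from $\mathbf{x}$ in exactly one entry and satisfy $f(\mathbf{y})\neq f(\mathbf{x})$. The sensitivity is $s(f)=\max_{\mathbf{x}\in T^n}s_{\mathbf{x}}(f)$. *)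

(* Defs.v *)
From HB Require Import structures.
From mathcomp Require Import all_boot all_order all_algebra.
From mathcomp Require Import finmap complex.
From mathcomp Require Import boolp reals.
From mathcomp Require Import mpoly.

Set Implicit Arguments.
Unset Strict Implicit.
Unset Printing Implicit Defensive.

Import Order.TTheory GRing.Theory Num.Theory.

Local Open Scope ring_scope.

Section PAryFunctions.
Variables (R : realType) (T : {fset R[i]}) (n : nat).
Implicit Types (F : {mpoly R[i][n]}) (f : {ffun 'I_n -> T} -> T).

Definition represents F f : Prop :=
  forall x : {ffun 'I_n -> T}, F.@[fun i => val (x i)] = val (f x).

(* msize is one more than the total degree, and msize 0 = 0; so the zero
   polynomial gets degree 0 here. *)
Definition total_degree F : nat := (msize F).-1.

(* Lagrange interpolation on the grid T^n *)
Lemma represents_ex f : exists F, represents F f.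
Proof.
pose L (x : {ffun 'I_n -> T}) : {mpoly R[i][n]} :=
  \prod_(i < n) \prod_(t : T | t != x i)
     ((val (x i) - val t)^-1 *: ('X_i - (val t)%:MP)).
have LE (x y : {ffun 'I_n -> T}) :
    (L x).@[fun i => val (y i)] = (x == y)%:R.
  rewrite /L rmorph_prod /=; have [->|/eqP xy] := eqVneq x y.
    apply: big1 => i _; rewrite rmorph_prod /=; apply: big1 => t tx.
    rewrite mevalZ mevalB mevalXU mevalC mulVf // subr_eq0.
    by rewrite (inj_eq val_inj) eq_sym.
  have [i xyi] : exists i, y i != x i.
    apply/existsP; apply: contra_notT xy; rewrite negb_exists => /forallP h.
    by apply/ffunP => i; apply/esym/eqP; have := h i; rewrite negbK.
  rewrite (bigD1 i) //= rmorph_prod /= (bigD1 (y i)) //=.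
  by rewrite mevalZ mevalB mevalXU mevalC subrr mulr0 !mul0r.
exists (\sum_x val (f x) *: L x) => y.
rewrite raddf_sum /= (bigD1 y) //= mevalZ LE eqxx mulr1 big1 ?addr0 // => x xy.
by rewrite mevalZ LE (negbTE xy) mulr0.
Qed.

Lemma degree_ex f :
  exists d, `[< exists2 F, represents F f & total_degree F = d >].
Proof.
by have [F Ff] := represents_ex f; exists (total_degree F); apply/asboolP; exists F.
Qed.

Definition degree f : nat := ex_minn (degree_ex f).

Definition local_sensitivity f (x : {ffun 'I_n -> T}) : nat :=
  #|[set y : {ffun 'I_n -> T} |
      (#|[set i | y i != x i]| == 1)%N && (f y != f x)]|.

Definition sensitivity f : nat := \max_x local_sensitivity f x.

End PAryFunctions.

(* Main.v *)
(** Take f to be an OR of m ANDs, on m disjoint blocks of m coordinates, of the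
    tests "x_i = a".  Leaving the value 1 means spoiling one of the m coordinates
    of the only satisfied block, in one of p-1 ways, and leaving the value 0 means
    completing one of the m blocks; hence s(f) <= m(p-1).  For the degree, let
    w(t) be the divided-difference weights of T, so that sum_t w(t) t^e = 0 for
    e < p-1.  The functional F |-> sum_x w(x_1)...w(x_n) F(x) kills all
    polynomials of degree < n(p-1), but takes a nonzero multiple of w(a)^n as
    value at f; hence deg(f) >= n(p-1) = m^2(p-1). *)
Require Import Defs.
From HB Require Import structures.
From mathcomp Require Import all_boot all_order all_algebra.
From mathcomp Require Import finmap complex.
From mathcomp Require Import boolp reals.
From mathcomp Require Import mpoly.

Import Order.TTheory GRing.Theory Num.Theory.

Local Open Scope ring_scope.

(** For distinct nodes, the leading coefficient of the Lagrange basis polynomial at [v t]. *)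
Definition divdiff_weight (K : fieldType) (T : finType) (v : T -> K) (t : T) : K :=
  (\prod_(u | u != t) (v t - v u))^-1.

Lemma divdiff_weight_neq0 (K : fieldType) (T : finType) (v : T -> K) (t : T) :
  injective v -> divdiff_weight K T v t != 0.
Proof.
move=> vI; rewrite /divdiff_weight invr_eq0; apply/prodf_neq0 => u ut.
by rewrite subr_eq0 (inj_eq vI) eq_sym.
Qed.

(* The interpolation polynomial of X^e at the nodes v t is X^e itself; compare
   the coefficients of degree #|T| - 1. *)
Lemma sum_divdiff_weight (K : fieldType) (T : finType) (v : T -> K) (e : nat) :
  injective v -> (e < #|T|.-1)%N -> \sum_t divdiff_weight K T v t * v t ^+ e = 0.
Proof.
move=> vI eT.
have T0 : (0 < #|T|)%N by case: #|T| eT.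
pose L t : {poly K} := \prod_(u | u != t) ('X - (v u)%:P).
have sL t : size (L t) = #|T|.
  by rewrite /L -big_enum size_prod_XsubC -cardE cardC1 prednK.
have lL t : (L t)`_(#|T|.-1) = 1.
  by rewrite -(sL t); apply/eqP/monic_prod_XsubC.
pose P : {poly K} := 'X^e - \sum_t (divdiff_weight K T v t * v t ^+ e) *: L t.
have P0 : P = 0.
  (* [P] has size at most [#|T|], yet it vanishes at the [#|T|] distinct nodes. *)
  apply: (@roots_geq_poly_eq0 _ _ [seq v t | t : T]); last first.
  - rewrite size_map -cardE.
    rewrite (leq_trans (size_polyD _ _)) // geq_max size_polyXn size_polyN.
    rewrite (leq_trans eT) ?leq_pred //= (leq_trans (size_sum _ _ _)) //.
    apply/bigmax_leqP => t _.
    by rewrite (leq_trans (size_scale_leq _ _)) // sL.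
  - by rewrite map_inj_uniq ?enum_uniq.
  apply/allP => _ /mapP[t _ ->]; rewrite rootE hornerD hornerN hornerXn horner_sum.
  rewrite (bigD1 t) //= big1 ?addr0 => [|u ut]; last first.
    by rewrite hornerZ horner_prod (bigD1 t) 1?eq_sym //= hornerXsubC subrr mul0r mulr0.
  have LE : (L t).[v t] = (divdiff_weight K T v t)^-1.
    rewrite /divdiff_weight invrK horner_prod; apply: eq_bigr => u _.
    by rewrite !hornerE.
  by rewrite hornerZ LE mulrAC divff ?mul1r ?subrr // divdiff_weight_neq0.
have /(congr1 (fun p : {poly K} => p`_(#|T|.-1))) := P0.
rewrite coef0 coefB coefXn coef_sum gtn_eqF // sub0r => /eqP.
rewrite oppr_eq0 => /eqP; under eq_bigr do rewrite coefZ lL mulr1.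
by [].
Qed.

(** On a monomial the sum factors over the coordinates. By pigeonhole some exponent is below
    [#|T|.-1], and the factor of that coordinate is zero. *)
Lemma sum_prod_divdiff_weight (K : fieldType) (T : finType) (v : T -> K) (n : nat)
    (F : {mpoly K[n]}) :
  injective v -> (msize F <= n * #|T|.-1)%N ->
  \sum_(x : {ffun 'I_n -> T})
    (\prod_i divdiff_weight K T v (x i)) * F.@[fun i => v (x i)] = 0.
Proof.
move=> vI sF; under eq_bigr do rewrite mevalE big_distrr /=.
rewrite exchange_big /= big_seq; apply: big1 => m mF.
under eq_bigr do rewrite mulrCA -big_split /=.
rewrite -big_distrr /=.
rewrite -(bigA_distr_bigA (fun i t => divdiff_weight K T v t * v t ^+ m i)) /=.
suff [i mi] : exists i, (m i < #|T|.-1)%N.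
  by rewrite (bigD1 i) //= sum_divdiff_weight // mul0r mulr0.
apply/existsP; apply: contraTT (leq_trans (msize_mdeg_lt mF) sF).
rewrite negb_exists -leqNgt mdegE => /forallP mT.
rewrite -[X in (X * _)%N]card_ord -sum_nat_const; apply: leq_sum => i _.
by rewrite leqNgt mT.
Qed.

(** Blocks are the fibres of [blk], hence disjoint by construction; [a] is both the tested letter
    and the output for true. *)
Definition or_of_ands (T : finType) (n k : nat) (blk : 'I_n -> 'I_k) (a b : T)
    (x : {ffun 'I_n -> T}) : T :=
  if [exists j, forall i, (blk i == j) ==> (x i == a)] then a else b.

(** Arithmetization: the product over [j] is the indicator that no block is satisfied. *)
Lemma or_of_andsE (K : fieldType) (T : finType) (v : T -> K) (n k : nat)
    (blk : 'I_n -> 'I_k) (a b : T) (x : {ffun 'I_n -> T}) :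
  v (or_of_ands T n k blk a b x) =
  v a + (v b - v a) * \prod_j (1 - \prod_(i | blk i == j) (x i == a)%:R).
Proof.
rewrite /or_of_ands; case: ifPn => [/existsP[j /forallP xj]|].
  rewrite (bigD1 j) //= big1 ?subrr ?mul0r ?mulr0 ?addr0 // => i ij.
  by rewrite (eqP (implyP (xj i) ij)) eqxx.
rewrite negb_exists => /forallP xN.
rewrite big1 ?mulr1 1?addrC ?subrK // => j _.
have /forallPn[l] := xN j; rewrite negb_imply => /andP[lj /negPf xl].
by rewrite (bigD1 l) //= xl mul0r subr0.
Qed.

(* In the expansion of the product over blocks, only the term that involves
   every coordinate survives, because sum_t w(t) = 0. *)
Lemma sum_weight_or_of_ands (K : fieldType) (T : finType) (v : T -> K) (n k : nat)
    (blk : 'I_n -> 'I_k) (a b : T) :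
  injective v -> (1 < #|T|)%N -> (0 < n)%N -> (forall j, exists i, blk i = j) ->
  \sum_(x : {ffun 'I_n -> T})
     (\prod_i divdiff_weight K T v (x i)) * v (or_of_ands T n k blk a b x) =
  (v b - v a) * ((-1) ^+ k * divdiff_weight K T v a ^+ n).
Proof.
move=> vI T1 n0 blk_onto; set w := divdiff_weight K T v.
have w0 : \sum_t w t = 0.
  rewrite -[RHS](@sum_divdiff_weight K T v 0) //; last by rewrite -ltnS prednK // ltnW.
  by apply: eq_bigr => t _; rewrite mulr1.
have sum_w : \sum_(x : {ffun 'I_n -> T}) \prod_i w (x i) = 0.
  rewrite -(bigA_distr_bigA (fun _ => w)) (bigD1 (Ordinal n0)) //=.
  by rewrite w0 mul0r.
(* [S] collects the blocks whose AND is picked when multiplying out. Writing each term as a product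
   over all coordinates lets its weighted sum over [x] factor. *)
have expand (x : {ffun 'I_n -> T}) :
    \prod_j (1 - \prod_(i | blk i == j) (x i == a)%:R) =
    \sum_(S : {set 'I_k})
      (-1) ^+ #|S| * \prod_i (if blk i \in S then (x i == a)%:R else 1) :> K.
  under eq_bigr do rewrite addrC.
  rewrite bigA_distr; apply: eq_bigr => S _.
  rewrite -big_mkcond prodrN /=; congr (_ * _).
  rewrite -[RHS]big_mkcond (partition_big blk (mem S)) //=.
  apply: eq_bigr => j jS; apply: eq_bigl => i.
  by case: eqP => [->|]; rewrite ?jS ?andbF.
under eq_bigr do rewrite or_of_andsE mulrDr mulrCA.
rewrite big_split /= -big_distrl -big_distrr /= sum_w mul0r add0r; congr (_ * _).
under eq_bigr => x _.
  rewrite expand big_distrr /=.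
  under eq_bigr do rewrite mulrCA -big_split /=.
  over.
rewrite exchange_big (bigD1 setT) //= [X in _ + X]big1 ?addr0 => [|S ST]; last first.
  have [j jS] : exists j, j \notin S.
    apply/existsP; apply: contraNT ST; rewrite negb_exists => /forallP jS.
    by apply/eqP/setP => j; rewrite inE -[LHS]negbK jS.
  (* The factor of a coordinate in the absent block [j] is the bare sum of the weights, which is
     zero. *)
  have [i ij] := blk_onto j.
  rewrite -big_distrr /=.
  rewrite -(bigA_distr_bigA
    (fun i t => w t * (if blk i \in S then (t == a)%:R else 1))) /=.
  rewrite (bigD1 i) //= ij (negPf jS); under eq_bigr do rewrite mulr1.
  by rewrite w0 mul0r mulr0.
rewrite -big_distrr /= cardsT card_ord; congr (_ * _).
rewrite -(bigA_distr_bigA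
  (fun i t => w t * (if blk i \in setT then (t == a)%:R else 1))) /=.
under eq_bigr => i _.
  rewrite inE (bigD1 a) //= eqxx mulr1 big1 ?addr0 => [|t /negPf->]; last first.
    by rewrite mulr0.
  over.
by rewrite prodr_const card_ord.
Qed.

Lemma degree_or_of_ands (R : realType) (T : {fset R[i]}) (n k : nat)
    (blk : 'I_n -> 'I_k) (a b : T) :
  a != b -> (0 < n)%N -> (forall j, exists i, blk i = j) ->
  (n * #|` T|.-1 <= degree (or_of_ands T n k blk a b))%N.
Proof.
move=> ab n0 blk_onto; rewrite /degree; case: ex_minnP => d /asboolP[F FE <-] _.
have T1 : (1 < #|{: T}|)%N.
  by rewrite (cardD1 a) (cardD1 b) !inE eq_sym ab.
rewrite cardfE leqNgt; apply/negP => dF.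
(* For nonzero [F], [msize F] is the degree plus one, so the strict bound becomes a weak one; for
   [F = 0] it is trivial. *)
have sF : (msize F <= n * #|{: T}|.-1)%N.
  by move: dF; rewrite /total_degree; case: (msize F).
have := sum_prod_divdiff_weight _ _ _ _ _ val_inj sF.
under eq_bigr do rewrite FE.
rewrite sum_weight_or_of_ands //; last exact: val_inj.
move/eqP; rewrite !mulf_eq0 signr_eq0 expf_eq0 n0 /= subr_eq0 (inj_eq val_inj).
rewrite eq_sym (negPf ab) /=.
by rewrite (negPf (divdiff_weight_neq0 _ _ _ _ val_inj)).
Qed.

Lemma sensitivity_or_of_ands (R : realType) (T : {fset R[i]}) (n k m : nat)
    (blk : 'I_n -> 'I_k) (a b : T) :
  (forall j, #|[set i | blk i == j]| <= m)%N ->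
  (sensitivity (or_of_ands T n k blk a b) <= maxn k (m * #|` T|.-1))%N.
Proof.
move=> blk_le; apply/bigmax_leqP => x _; rewrite /local_sensitivity.
have upd (y : {ffun 'I_n -> T}) : (#|[set i | y i != x i]| == 1)%N ->
    exists2 i, y i != x i & forall l, l != i -> y l = x l.
  move=> /cards1P[i yx]; exists i; first by have := set11 i; rewrite -yx inE.
  move=> l li; apply/eqP; apply: contraNT li => yl.
  by rewrite -in_set1 -yx inE.
rewrite leq_max; apply/orP; rewrite /or_of_ands.
case: ifPn => [/existsP[j /forallP xj]|xN].
  (* Fix one satisfied block [j]: a neighbour with another value must put a letter other than [a] at
     a coordinate of this block. *)
  right; pose g (iu : 'I_n * T) := [ffun l => if l == iu.1 then iu.2 else x l].
  apply: (@leq_trans #|[set g iu | iu in setX [set i | blk i == j] [set~ a]]|).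
    apply/subset_leq_card/subsetP => y; rewrite inE => /andP[/upd[i yi yE]].
    case: ifPn; first by rewrite eqxx.
    rewrite negb_exists => /forallP/(_ j)/forallPn[l].
    rewrite negb_imply => /andP[lj yl] _.
    have li : l = i.
      by apply/eqP; apply: contraNT yl => /yE->; exact: (implyP (xj l)).
    apply/imsetP; exists (i, y i); first by rewrite !inE -li lj.
    by apply/ffunP => h; rewrite ffunE /=; case: eqP => [->|/eqP/yE].
  rewrite (leq_trans (leq_imset_card _ _)) // cardsX leq_mul //.
  by rewrite cardsC1 cardfE.
(* Here a sensitive neighbour is determined by the block [j] that it completes. *)
left; pose g j := [ffun l => if blk l == j then a else x l].
apply: (@leq_trans #|[set g j | j : 'I_k]|).
  apply/subset_leq_card/subsetP => y; rewrite inE => /andP[/upd[i yi yE]].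
  case: ifPn; last by rewrite eqxx.
  move=> /existsP[j /forallP yj] _; apply/imsetP; exists j => //.
  apply/ffunP => l; rewrite ffunE; case: ifPn => [/(implyP (yj l))/eqP //|lj].
  (* If the changed coordinate lay outside block [j], then [x] would already satisfy that block. *)
  apply: (yE); apply: contra xN => /eqP li; apply/existsP; exists j.
  apply/forallP => h; apply/implyP => hj; rewrite -yE; first exact: (implyP (yj h)).
  by apply: contraNneq lj => hi; rewrite li -hi.
by rewrite (leq_trans (leq_imset_card _ _)) // card_ord.
Qed.

Theorem theorem1p3 (R : realType) (p : nat) (T : {fset R[i]})
    (hp : prime p) (hT : #|` T|%fset = p) (D : nat) (hD : (0 < D)%N) :
  exists (n : nat) (f : {ffun 'I_n -> T} -> T),
    [/\ (0 < n)%N,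
        (D < degree f)%N &
        (sensitivity f)%:R ^+ 2 / (p%:R - 1) ^+ 3 <= (degree f)%:R :> R].
Proof.
have p1 := prime_gt1 hp.
have /card_gt1P[a [b [_ _ ab]]] : (1 < #|{: T}|)%N by rewrite -cardfE hT.
(* Coordinates number the cells of an [m] by [m] grid whose rows are the blocks; [m > D] makes the
   degree bound [m * m * (p - 1)] exceed [D]. *)
pose m := D.+1; pose n := #|{: 'I_m * 'I_m}|.
have nE : n = (m * m)%N by rewrite /n card_prod card_ord.
pose blk (i : 'I_n) : 'I_m := (enum_val i).1.
have blk_onto j : exists i, blk i = j.
  by exists (enum_rank (j, ord0)); rewrite /blk enum_rankK.
have blk_le j : (#|[set i | blk i == j]| <= m)%N.
  rewrite -[leqRHS]card_ord.
  apply: leq_trans (leq_imset_card (fun l : 'I_m => enum_rank (j, l)) _).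
  apply/subset_leq_card/subsetP => i; rewrite inE => /eqP <-.
  by apply/imsetP; exists (enum_val i).2; rewrite // -surjective_pairing enum_valK.
have n0 : (0 < n)%N by rewrite nE.
exists n, (or_of_ands T n m blk a b).
have := degree_or_of_ands R T n m blk a b ab n0 blk_onto.
have := sensitivity_or_of_ands R T n m m blk a b blk_le.
rewrite hT; set s := sensitivity _; set d := degree _; rewrite nE.
case: p p1 {hp hT} => [|[|q]] //= _.
rewrite (maxn_idPr _) ?leq_pmulr // => sm dm.
split=> //; first by rewrite (leq_trans _ dm) // -mulnA leq_pmulr.
rewrite -natr1 addrK ler_pdivrMr ?exprn_gt0 // -!natrX -natrM ler_nat.
apply: leq_trans (leq_mul dm (leqnn _)).
(* Here [q.+1] is [p - 1], and the chain is [s ^ 2 <= m ^ 2 * (p - 1) ^ 2 <= m ^ 2 * (p - 1) ^ 4 <=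
   d * (p - 1) ^ 3]. *)
rewrite (@leq_trans ((m * q.+1) ^ 2)) ?leq_sqr // expnMn -mulnA leq_mul //.
by rewrite -expnS leq_pexp2l.
Qed.
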